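(* Let $\check u^{(1)}$ and $\check u^{(2)}$ be Geronimus transformations of the bivariate linear functional $u$ associated with the Laurent polynomials $L^{(1)}$ and $L^{(2)}$, where the Gram matrices $G,\check G^{(1)},\check G^{(2)}$ are quasidefinite. With the connectors $$\Omega^{(1)}_1=S_1L^{(1)}(\Upsilon)(\check S^{(1)}_1)^{-1},\quad\Omega^{(1)}_2=\check S^{(1)}_2S_2^{-1},\quad\Omega^{(2)}_1=\check S^{(2)}_1S_1^{-1},\quad\Omega^{(2)}_2=S_2L^{(2)}(\Upsilon)(\check S^{(2)}_2)^{-1},$$ the following connection formulas hold: $$\Omega^{(1)}_1\check\phi^{(1)}_1(z)=L^{(1)}(z)\phi_1(z),\qquad\Omega^{(1)}_2\phi_2(z)=\check\phi^{(1)}_2(z),$$ $$\Omega^{(2)}_1\phi_1(z)=\check\phi^{(2)}_1(z),\qquad\Omega^{(2)}_2\check\phi^{(2)}_2(z)=L^{(2)}(z)\phi_2(z).$$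
   Context: Indices start at $0$. CMV sequence: $\chi(z)=[1,z^{-1},z,z^{-2},z^2,\dots]^\top$. $\Upsilon$ is the semi-infinite permutation matrix with $\Upsilon\chi(z)=z\chi(z)$, i.e. its nonzero entries, all equal to $1$, are $\Upsilon_{2k,2k+2}$, $\Upsilon_{1,0}$, $\Upsilon_{2k+3,2k+1}$ ($k\ge0$); $\Upsilon^{-1}=\Upsilon^\top$, and $L(\Upsilon)=\sum_jL_j\Upsilon^j$. A bivariate linear functional $v=v_{z_1,\bar z_2}$ is a continuous linear functional with well-defined closed support in $\mathbb C^*\times\mathbb C^*$ on a space of test functions (e.g. a compactly supported distribution) containing all $f(z_1)\otimes\overline{g(z_2)}:=f(z_1)\overline{g(z_2)}$ with $f,g$ Laurent polynomials or, more generally, rational functions with nonzero poles outside $\operatorname{supp}_1(v)$, resp. $\operatorname{supp}_2(v)$, the projections of the support on the $z_1$-, resp. $z_2$-coordinate; $\langle f,g\rangle_v=\langle v,f(z_1)\otimes\overline{g(z_2)}\rangle$. The Gram matrix of $v$ has entries $\langle\chi^{(k)},\chi^{(l)}\rangle_v$; quasidefinite means that all leading principal minors are nonzero. Then $G=S_1^{-1}H(S_2^{-1})^\dagger$ (Gram matrix of $u$) uniquely, with $S_1,S_2$ lower unitriangular and $H$ diagonal with nonzero entries; $\phi_a=S_a\chi$. $L^{(a)}(z)=L^{(a)}_nz^n+\dots+L^{(a)}_{-m}z^{-m}$, $L^{(a)}_nL^{(a)}_{-m}\ne0$, $n,m\in\{0,1,\dots\}$, with zero sets $\sigma(L^{(a)})\subset\mathbb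 C^*$ such that $\sigma(L^{(1)})\cap\operatorname{supp}_1(u)=\varnothing$, $\sigma(L^{(2)})\cap\operatorname{supp}_2(u)=\varnothing$. Geronimus transformations are bivariate functionals $\check u^{(1)},\check u^{(2)}$ with $L^{(1)}(z_1)\check u^{(1)}=u$ and $\check u^{(2)}\overline{L^{(2)}(z_2)}=u$, i.e. $\langle L^{(1)}f,g\rangle_{\check u^{(1)}}=\langle f,g\rangle_u$ and $\langle f,L^{(2)}g\rangle_{\check u^{(2)}}=\langle f,g\rangle_u$. Their Gram matrices are factorized as $\check G^{(a)}=(\check S^{(a)}_1)^{-1}\check H^{(a)}\big((\check S^{(a)}_2)^{-1}\big)^\dagger$ in the same way, and $\check\phi^{(a)}_b=\check S^{(a)}_b\chi$. *)

(* Defs.v *)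
From HB Require Import structures.
From mathcomp Require Import all_boot all_order all_algebra.
From mathcomp Require Import complex.
From mathcomp Require Import mathcomp_extra boolp classical_sets functions.
From mathcomp Require Import cardinality fsbigop reals topology normedtype.
Set Implicit Arguments.
Unset Strict Implicit.
Unset Printing Implicit Defensive.
Import Order.TTheory GRing.Theory Num.Theory.
Import numFieldNormedType.Exports.
Local Open Scope classical_set_scope.
Local Open Scope ring_scope.

(** The complex numbers are [R[i]] for [R : realType]; the copy [R[i]^o]
    carries the topology of the modulus.  The indices of sequences and of
    semi-infinite matrices start at 0. *)

(** * Bivariate linear functionals *)

Definition Cstar2 (R : realType) : set (R[i]^o * R[i]^o) :=
  [set z | z.1 != 0 /\ z.2 != 0].

(** A topological vector space whose elements are functions on C* x C*: an
    element is determined by its values [test_eval h z] for [z] in [Cstar2]. *)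
Record test_functions (R : realType) := TestFunctions {
  test_space :> topologicalLmodType R[i];
  test_eval : test_space -> R[i]^o * R[i]^o -> R[i];
  test_eval_linear : forall (a : R[i]) (h k : test_space) z,
    test_eval (a *: h + k) z = a * test_eval h z + test_eval k z;
  test_eval_inj : forall h k : test_space,
    (forall z, Cstar2 z -> test_eval h z = test_eval k z) -> h = k }.

Definition tsupp (R : realType) (T : test_functions R) (h : T)
    : set (R[i]^o * R[i]^o) :=
  closure (@Cstar2 R `&` [set z | test_eval h z != 0]) `&` @Cstar2 R.

Definition vanishes_on (R : realType) (T : test_functions R) (v : {scalar T})
    (U : set (R[i]^o * R[i]^o)) : Prop :=
  [/\ open U, U `<=` @Cstar2 R & forall h : T, tsupp h `<=` U -> v h = 0].

Definition null_set (R : realType) (T : test_functions R) (v : {scalar T})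
    : set (R[i]^o * R[i]^o) :=
  \bigcup_(U in [set U | vanishes_on v U]) U.

(** [null_set v] is open, so this is relatively closed in C* x C*.  It is the
    support of [v] in the usual sense when [v] vanishes on [null_set v] itself,
    that is, when there is a largest open set on which [v] vanishes. *)
Definition support (R : realType) (T : test_functions R) (v : {scalar T})
    : set (R[i]^o * R[i]^o) :=
  @Cstar2 R `\` null_set v.

Definition support1 (R : realType) (T : test_functions R) (v : {scalar T})
    : set R[i] := [set z.1 | z in support v].

Definition support2 (R : realType) (T : test_functions R) (v : {scalar T})
    : set R[i] := [set z.2 | z in support v].

(** [f] is, on C*, a rational function whose nonzero poles lie outside [K], a
    subset of C*.  As [x / 0 = 0], [f] takes the dummy value 0 at the zeros of
    [q]; these are outside [K], and for [K] a projection of the support of a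
    functional the choice of the values there does not affect the functional. *)
Definition rational_off (R : realType) (K : set R[i]) (f : R[i] -> R[i])
    : Prop :=
  exists p q : {poly R[i]},
    [/\ q != 0, forall a, K a -> q.[a] != 0
      & forall z, z != 0 -> f z = p.[z] / q.[z]].

(** [h] is the function [f(z_1) * conj (g(z_2))]. *)
Definition is_tensor (R : realType) (T : test_functions R)
    (f g : R[i] -> R[i]) (h : T) : Prop :=
  forall z, Cstar2 z -> test_eval h z = f z.1 * (g z.2)^*.

Record bifunctional (R : realType) := Bifunctional {
  bif_test : test_functions R;
  bif_fun :> {scalar bif_test};
  bif_continuous : continuous (bif_fun : bif_test -> R[i]^o);
  bif_support : vanishes_on bif_fun (null_set bif_fun);
  bif_rational : forall f g : R[i] -> R[i],
    rational_off (support1 bif_fun) f -> rational_off (support2 bif_fun) g ->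
    exists h : bif_test, is_tensor f g h }.

(** [<f, g>_u]; by [test_eval_inj] there is at most one test function [h] such
    that [is_tensor f g h], and the value is relevant only if there is one. *)
Definition pairing (R : realType) (u : bifunctional R) (f g : R[i] -> R[i])
    : R[i] :=
  u (xget 0 [set h : bif_test u | is_tensor f g h]).

(** * Semi-infinite matrices *)

Definition simx (R : realType) : Type := nat -> nat -> R[i].

(** The sums below are those of [fsbigop], over the support of the summand;
    they are used only when this support is finite. *)
Definition simul (R : realType) (A B : simx R) : simx R :=
  fun i j => \sum_(k \in [set: nat]) A i k * B k j.

Definition simulv (R : realType) (A : simx R) (x : nat -> R[i]) : nat -> R[i] :=
  fun i => \sum_(k \in [set: nat]) A i k * x k.

Definition sid (R : realType) : simx R := fun i j => (i == j)%:R.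

Definition sitr (R : realType) (A : simx R) : simx R := fun i j => A j i.

Definition dagger (R : realType) (A : simx R) : simx R := fun i j => (A j i)^*.

Definition lower_unitriangular (R : realType) (A : simx R) : Prop :=
  (forall i j, (i < j)%N -> A i j = 0) /\ (forall i, A i i = 1).

Definition nonzero_diagonal (R : realType) (A : simx R) : Prop :=
  (forall i j, i <> j -> A i j = 0) /\ (forall i, A i i != 0).

(** Inverse in the group of lower unitriangular matrices. *)
Definition siinv (R : realType) (A : simx R) : simx R :=
  xget (fun _ _ => 0)
    [set B | [/\ lower_unitriangular B, simul A B = @sid R
               & simul B A = @sid R]].

Definition quasidefinite (R : realType) (G : simx R) : Prop :=
  forall n : nat, \det (\matrix_(i < n, j < n) G i j) != 0.

Definition gauss_borel (R : realType) (G S1 H S2 : simx R) : Prop :=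
  [/\ lower_unitriangular S1, lower_unitriangular S2, nonzero_diagonal H
    & G = simul (simul (siinv S1) H) (dagger (siinv S2))].

(** * CMV ordering *)

Definition cmv_exp (k : nat) : int :=
  if odd k then - (k.+1./2)%:Z else (k./2)%:Z.

Definition chi (R : realType) (z : R[i]) (k : nat) : R[i] := z ^ cmv_exp k.

Definition gram (R : realType) (u : bifunctional R) : simx R :=
  fun k l => pairing u (fun z => chi z k) (fun z => chi z l).

Definition Upsilon (R : realType) : simx R :=
  fun i j => [|| ~~ odd i && (j == i.+2), (i == 1%N) && (j == 0%N)
               | odd j && (i == j.+2)]%:R.

Definition Upsilon_pow (R : realType) (j : int) : simx R :=
  match j with
  | Posz n => iter n (simul (@Upsilon R)) (@sid R)
  | Negz n => iter n.+1 (simul (sitr (@Upsilon R))) (@sid R)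
  end.

(** * Laurent polynomials, as coefficient functions *)

Definition laurent (R : realType) (n m : nat) (L : int -> R[i]) : Prop :=
  L n%:Z * L (- m%:Z) != 0 /\
  forall j : int, L j != 0 -> - m%:Z <= j <= n%:Z.

Definition laurent_eval (R : realType) (L : int -> R[i]) (z : R[i]) : R[i] :=
  \sum_(j \in [set: int]) L j * z ^ j.

Definition laurent_mx (R : realType) (L : int -> R[i]) : simx R :=
  fun k l => \sum_(j \in [set: int]) L j * @Upsilon_pow R j k l.

Definition laurent_zeros (R : realType) (L : int -> R[i]) : set R[i] :=
  [set z | z != 0 /\ laurent_eval L z = 0].

(** * Geronimus transformations *)

(** [L(z_1) w = u].  The test functions range over those which both functionals
    accept; the support of [w] may contain points over the zeros of [L]. *)
Definition geronimus1 (R : realType) (L : int -> R[i]) (u w : bifunctional R)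
    : Prop :=
  forall f g : R[i] -> R[i],
    rational_off (support1 w `|` support1 u) f ->
    rational_off (support2 w `|` support2 u) g ->
    pairing w (fun z => laurent_eval L z * f z) g = pairing u f g.

(** [w conj (L(z_2)) = u]. *)
Definition geronimus2 (R : realType) (L : int -> R[i]) (u w : bifunctional R)
    : Prop :=
  forall f g : R[i] -> R[i],
    rational_off (support1 w `|` support1 u) f ->
    rational_off (support2 w `|` support2 u) g ->
    pairing w f (fun z => laurent_eval L z * g z) = pairing u f g.

(** The sequence [phi(z) = S chi(z)]. *)
Definition cmv_poly (R : realType) (S : simx R) (z : R[i]) : nat -> R[i] :=
  simulv S (chi z).

(* Main.v *)
Require Import Defs.
From HB Require Import structures.
From mathcomp Require Import all_boot all_order all_algebra.
From mathcomp Require Import complex zify.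
From mathcomp Require Import mathcomp_extra boolp classical_sets functions.
From mathcomp Require Import cardinality fsbigop reals topology normedtype.
Import Order.TTheory GRing.Theory Num.Theory.
Import numFieldNormedType.Exports.
Local Open Scope classical_set_scope.
Local Open Scope ring_scope.


(** Every connector has the form [A S^-1], where [S] is lower unitriangular and
    the connector is applied to [S chi(z)], so each formula is
    [(A S^-1) (S chi(z)) = A chi(z)] ([simulv_siinvK]).  When [A] is itself lower
    unitriangular, [A chi(z)] is by definition the sequence on the right-hand
    side.  When [A = S' L(Upsilon)], the sequence [chi(z)] is an eigenvector of
    [Upsilon] for [z] and of its transpose for [z^-1], hence
    [L(Upsilon) chi(z) = L(z) chi(z)] ([laurent_mx_chi]), and the scalar [L(z)]
    moves past [S'].

    What needs an argument is that these infinite products may be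
    reassociated and that the inverses exist.  Lower triangular matrices and
    Laurent polynomials of [Upsilon] have finitely many nonzero entries in each
    row; products of such matrices stay of this kind, and they act
    associatively ([simulvA]).  The inverse of a lower unitriangular matrix comes
    from forward substitution ([siinvP]). *)

(** * Row-finite matrices *)

Definition row_finite {R : realType} (A : simx R) : Prop :=
  forall i, exists n, forall k, (n <= k)%N -> A i k = 0.

Lemma fsumT_seq {V : nmodType} {T : choiceType} (r : seq T) (F : T -> V) :
  uniq r -> (forall i, i \notin r -> F i = 0) ->
  \sum_(i \in [set: T]) F i = \sum_(i <- r) F i.
Proof.
move=> ur F0; rewrite (@bigfs _ _ _ _ r predT) //; last by move=> i _; exact: F0.
by apply: eq_fsbigl; apply/seteqP; split.
Qed.

Lemma simulv_nat {R : realType} (A : simx R) (x : nat -> R[i]) (i n : nat) :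
  (forall k, (n <= k)%N -> A i k = 0) ->
  simulv A x i = \sum_(0 <= k < n) A i k * x k.
Proof.
move=> A0; rewrite /simulv (@fsumT_seq _ _ (index_iota 0 n)) ?iota_uniq //.
by move=> k; rewrite mem_index_iota /= -leqNgt => /A0 ->; rewrite mul0r.
Qed.

(** A bound valid for all indices in [s] at once cuts an iterated sum down to a
    rectangle, where the order of summation may be exchanged. *)
Lemma common_bound {R : realType} {T : eqType} (F : T -> nat -> R[i])
    (s : seq T) :
  (forall t, exists n, forall k, (n <= k)%N -> F t k = 0) ->
  exists n, forall t, t \in s -> forall k, (n <= k)%N -> F t k = 0.
Proof.
move=> F0; elim: s => [|t s [n sn]]; first by exists 0%N.
have [p tp] := F0 t; exists (maxn n p) => t' + k; rewrite geq_max inE.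
by move=> /orP[/eqP-> | /sn t'n] /andP[nk pk]; [exact: tp | exact: t'n].
Qed.

Lemma row_finite_mul {R : realType} (A B : simx R) :
  row_finite A -> row_finite B -> row_finite (simul A B).
Proof.
move=> fA fB i; have [n An] := fA i.
have [p Bp] := common_bound B (index_iota 0 n) fB.
exists p => l pl; have -> : simul A B i l = simulv A (B^~ l) i by [].
rewrite (simulv_nat _ _ _ _ An) big_seq big1 // => k /Bp-> //.
by rewrite mulr0.
Qed.

Lemma simulv_scale {R : realType} (A : simx R) (c : R[i]) (x : nat -> R[i]) :
  row_finite A ->
  simulv A (fun k => c * x k) = (fun k => c * simulv A x k).
Proof.
move=> fA; apply/funext => i; have [n An] := fA i.
rewrite !(simulv_nat _ _ _ _ An) mulr_sumr.
by apply: eq_bigr => k _; rewrite mulrCA.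
Qed.

(** For arbitrary semi-infinite matrices associativity fails; finite rows make
    both sides finite double sums. *)
Lemma simulvA {R : realType} (A B : simx R) (x : nat -> R[i]) :
  row_finite A -> row_finite B ->
  simulv (simul A B) x = simulv A (simulv B x).
Proof.
move=> fA fB; apply/funext => i; have [n An] := fA i.
have [p Bp] := common_bound B (index_iota 0 n) fB.
have ABp l : simul A B i l = \sum_(0 <= k < n) A i k * B k l.
  exact: (simulv_nat A (B^~ l) _ _ An).
rewrite (simulv_nat _ _ _ _ An) (@simulv_nat _ _ _ _ p); last first.
  move=> l pl; rewrite ABp big_seq big1 // => k /Bp-> //.
  by rewrite mulr0.
under eq_bigr do rewrite ABp mulr_suml.
rewrite exchange_big /= big_seq [RHS]big_seq; apply: eq_bigr => k /Bp Bk.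
rewrite (simulv_nat _ _ _ _ Bk) mulr_sumr.
by apply: eq_bigr => l _; rewrite mulrA.
Qed.

Lemma simulA {R : realType} (A B C : simx R) :
  row_finite A -> row_finite B ->
  simul (simul A B) C = simul A (simul B C).
Proof.
move=> fA fB; apply/funext => i; apply/funext => j.
exact: (congr1 (@^~ i) (simulvA A B (C^~ j) fA fB)).
Qed.

Lemma simulv_id {R : realType} (x : nat -> R[i]) : simulv (@sid R) x = x.
Proof.
apply/funext => i; rewrite /simulv (@fsumT_seq _ _ [:: i]) //.
  by rewrite big_seq1 /sid eqxx mul1r.
by move=> k; rewrite inE eq_sym /sid => /negPf->; rewrite mul0r.
Qed.

Lemma simul_idl {R : realType} (A : simx R) : simul (@sid R) A = A.
Proof.
apply/funext => i; apply/funext => j.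
exact: (congr1 (@^~ i) (simulv_id (A^~ j))).
Qed.

Lemma simul_idr {R : realType} (A : simx R) : simul A (@sid R) = A.
Proof.
apply/funext => i; apply/funext => j; rewrite /simul (@fsumT_seq _ _ [:: j]) //.
  by rewrite big_seq1 /sid eqxx mulr1.
by move=> k; rewrite inE /sid => /negPf->; rewrite mulr0.
Qed.

Lemma row_finite_id {R : realType} : row_finite (@sid R).
Proof. by move=> i; exists i.+1 => k ik; rewrite /sid ltn_eqF. Qed.

(** * Inverses of lower unitriangular matrices *)

Lemma row_finite_unitriangular {R : realType} (A : simx R) :
  lower_unitriangular A -> row_finite A.
Proof. by case=> A0 _ i; exists i.+1 => k; exact: A0. Qed.

(** The first [n] rows of the right inverse of [A], computed one after the other
    by forward substitution: row [n] of the equation [A B = 1] determines row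
    [n] of [B] from the rows above it. *)
Fixpoint forward_subst {R : realType} (A : simx R) (n : nat) : simx R :=
  if n is m.+1 then fun i j =>
    if i == m then (i == j)%:R - \sum_(0 <= k < m) A i k * forward_subst A m k j
    else forward_subst A m i j
  else fun _ _ => 0.

Lemma forward_subst_stable {R : realType} (A : simx R) (n i : nat) :
  (i < n)%N -> forward_subst A n i = forward_subst A i.+1 i.
Proof.
elim: n => // n IHn; rewrite ltnS leq_eqVlt => /orP[/eqP-> //|lt_in].
apply/funext => j; rewrite [LHS]/= ltn_eqF // IHn //.
Qed.

Lemma right_inverse_unitriangular {R : realType} (A : simx R) :
  lower_unitriangular A ->
  exists2 B, lower_unitriangular B & simul A B = @sid R.
Proof.
move=> [A0 A1]; pose B : simx R := fun i j => forward_subst A i.+1 i j.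
have BE i j : B i j = (i == j)%:R - \sum_(0 <= k < i) A i k * B k j.
  rewrite [LHS]/B /= eqxx; congr (_ - _).
  by apply: eq_big_nat => k /andP[_ ki]; rewrite forward_subst_stable.
have B0 i j : (i < j)%N -> B i j = 0.
  elim/ltn_ind: i => i IHi ij; rewrite BE ltn_eqF // sub0r big_nat big1 ?oppr0 //.
  by move=> k /andP[_ ki]; rewrite IHi ?mulr0 // (ltn_trans ki).
exists B.
  split=> // i; rewrite BE eqxx big_nat big1 ?subr0 // => k /andP[_ ki].
  by rewrite B0 ?mulr0.
apply/funext => i; apply/funext => j.
have -> : simul A B i j = simulv A (B^~ j) i by [].
rewrite (@simulv_nat _ _ _ _ i.+1); last by move=> k; exact: A0.
by rewrite big_nat_recr //= A1 mul1r [B i j]BE addrC subrK.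
Qed.

(** A right inverse suffices: [B] with [A B = 1] has itself a right inverse [C],
    and [C = (A B) C = A (B C) = A], so that [B A = 1]. *)
Lemma siinvP {R : realType} (A : simx R) : lower_unitriangular A ->
  [/\ lower_unitriangular (siinv A), simul A (siinv A) = @sid R
    & simul (siinv A) A = @sid R].
Proof.
move=> uA; apply: (@xgetPex _ _ [set B | [/\ lower_unitriangular B,
  simul A B = @sid R & simul B A = @sid R]]).
have [B uB AB] := right_inverse_unitriangular _ uA.
have [C uC BC] := right_inverse_unitriangular _ uB.
have fA := row_finite_unitriangular _ uA.
have fB := row_finite_unitriangular _ uB.
have CA : C = A by rewrite -(simul_idl C) -AB simulA // BC simul_idr.
by exists B; split=> //; rewrite -{1}CA.
Qed.

(** The form common to all the connection formulas: the inverse factor in a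
    connector undoes the matrix that defines the polynomials it acts upon. *)
Lemma simulv_siinvK {R : realType} (A S : simx R) (x : nat -> R[i]) :
  row_finite A -> lower_unitriangular S ->
  simulv (simul A (siinv S)) (simulv S x) = simulv A x.
Proof.
move=> fA uS; have [uV _ VS] := siinvP _ uS.
have fS := row_finite_unitriangular _ uS.
have fV := row_finite_unitriangular _ uV.
by rewrite simulvA // -(simulvA (siinv S)) // VS simulv_id.
Qed.

(** * The eigenvector equation of the shift *)

(** In the CMV ordering the exponents run once through all integers, so raising
    or lowering an exponent by 1 permutes the positions.  The two functions
    below are these permutations; [Upsilon] and its transpose are their
    matrices. *)
Definition shift_up (i : nat) : nat :=
  if odd i then (if i == 1%N then 0%N else i.-2) else i.+2.

Definition shift_down (i : nat) : nat :=
  if odd i then i.+2 else (if i == 0%N then 1%N else i.-2).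

Lemma UpsilonE {R : realType} (i j : nat) :
  @Upsilon R i j = (j == shift_up i)%:R.
Proof.
rewrite /Upsilon /shift_up; congr (nat_of_bool _)%:R.
case: (boolP (odd i)) => oi; last by lia.
by case: (eqVneq i 1%N) => i1; lia.
Qed.

Lemma UpsilonTE {R : realType} (i j : nat) :
  sitr (@Upsilon R) i j = (j == shift_down i)%:R.
Proof.
rewrite /sitr UpsilonE /shift_up /shift_down; congr (nat_of_bool _)%:R.
by case: (boolP (odd i)) => oi; case: (boolP (odd j)) => oj;
  case: (eqVneq j 1%N) => j1; case: (eqVneq i 0%N) => i0; lia.
Qed.

Lemma cmv_exp_up (i : nat) : cmv_exp (shift_up i) = cmv_exp i + 1.
Proof.
rewrite /cmv_exp /shift_up; case: (boolP (odd i)) => oi /=.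
  by case: eqVneq => [->|i1] //; case: ifP => ?; lia.
by rewrite negbK (negPf oi); lia.
Qed.

Lemma cmv_exp_down (i : nat) : cmv_exp (shift_down i) = cmv_exp i - 1.
Proof.
rewrite /cmv_exp /shift_down; case: (boolP (odd i)) => oi /=.
  by rewrite negbK oi; lia.
by case: eqVneq => [->|i0] //; case: ifP => ?; lia.
Qed.

Lemma simulv_subst {R : realType} (A : simx R) (s : nat -> nat) x :
  (forall i j, A i j = (j == s i)%:R) -> simulv A x = x \o s.
Proof.
move=> AE; apply/funext => i; rewrite /simulv (@fsumT_seq _ _ [:: s i]) //.
  by rewrite big_seq1 AE eqxx mul1r.
by move=> k; rewrite inE AE => /negPf->; rewrite mul0r.
Qed.

Lemma row_finite_subst {R : realType} (A : simx R) (s : nat -> nat) :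
  (forall i j, A i j = (j == s i)%:R) -> row_finite A.
Proof. by move=> AE i; exists (s i).+1 => k ik; rewrite AE gtn_eqF. Qed.

Lemma row_finite_iter {R : realType} (A : simx R) (n : nat) :
  row_finite A -> row_finite (iter n (simul A) (@sid R)).
Proof.
move=> fA; elim: n => [|n IHn]; first exact: row_finite_id.
exact: row_finite_mul.
Qed.

Lemma simulv_iter {R : realType} (A : simx R) (c : R[i]) x (n : nat) :
  row_finite A -> simulv A x = (fun k => c * x k) ->
  simulv (iter n (simul A) (@sid R)) x = (fun k => c ^+ n * x k).
Proof.
move=> fA Ax; elim: n => [|n IHn].
  by rewrite simulv_id; apply/funext => k; rewrite expr0 mul1r.
rewrite iterS simulvA ?IHn //; last exact: row_finite_iter.
by rewrite simulv_scale // Ax; apply/funext => k; rewrite mulrA -exprSr.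
Qed.

Lemma row_finite_Upsilon_pow {R : realType} (j : int) :
  row_finite (@Upsilon_pow R j).
Proof.
case: j => n; apply: row_finite_iter.
  exact: row_finite_subst UpsilonE.
exact: row_finite_subst UpsilonTE.
Qed.

(** At [z = 0] this fails: the exponents then no longer add up. *)
Lemma Upsilon_pow_chi {R : realType} (j : int) (z : R[i]) : z != 0 ->
  simulv (@Upsilon_pow R j) (chi z) = (fun k => z ^ j * chi z k).
Proof.
move=> z0; case: j => n.
  apply: simulv_iter; first exact: row_finite_subst UpsilonE.
  rewrite (simulv_subst _ _ _ UpsilonE); apply/funext => k.
  by rewrite /= /chi cmv_exp_up expfzDr // mulrC.
rewrite NegzE -exprnN -exprVn.
apply: simulv_iter; first exact: row_finite_subst UpsilonTE.
rewrite (simulv_subst _ _ _ UpsilonTE); apply/funext => k.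
by rewrite /= /chi cmv_exp_down expfzDr // mulrC.
Qed.

(** * Laurent polynomials of the shift *)

Lemma laurent_seq {R : realType} (n m : nat) (L : int -> R[i]) :
  laurent n m L -> exists2 s : seq int, uniq s & forall j, j \notin s -> L j = 0.
Proof.
move=> [_ Lnm]; exists [seq i%:Z - m%:Z | i <- iota 0 (n + m).+1].
  by rewrite map_inj_uniq ?iota_uniq // => a b /addIr [].
move=> j; apply: contraNeq => /Lnm /andP[mj jn]; apply/mapP.
by exists (absz (j + m%:Z)); rewrite ?mem_iota; lia.
Qed.

Lemma row_finite_laurent_mx {R : realType} (n m : nat) (L : int -> R[i]) :
  laurent n m L -> row_finite (laurent_mx L).
Proof.
move=> /laurent_seq[s us Ls] i.
have [p Up] := common_bound (fun j => @Upsilon_pow R j i) s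
  (fun j => row_finite_Upsilon_pow j i).
exists p => k pk; rewrite /laurent_mx (@fsumT_seq _ _ s) //; last first.
  by move=> j /Ls->; rewrite mul0r.
by rewrite big_seq big1 // => j /Up-> //; rewrite mulr0.
Qed.

(** Since [Upsilon^j chi(z) = z^j chi(z)] for every integer [j], this is linearity
    in [L]; the finitely many powers that occur have a common bound for the
    nonzero entries of row [i], which turns the claim into an exchange of two
    finite sums. *)
Lemma laurent_mx_chi {R : realType} (n m : nat) (L : int -> R[i]) (z : R[i]) :
  laurent n m L -> z != 0 ->
  simulv (laurent_mx L) (chi z) = (fun k => laurent_eval L z * chi z k).
Proof.
move=> /laurent_seq[s us Ls] z0; apply/funext => i.
have [p Up] := common_bound (fun j => @Upsilon_pow R j i) s
  (fun j => row_finite_Upsilon_pow j i).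
have LE k : laurent_mx L i k = \sum_(j <- s) L j * @Upsilon_pow R j i k.
  by apply: fsumT_seq => // j /Ls->; rewrite mul0r.
have -> : laurent_eval L z = \sum_(j <- s) L j * z ^ j.
  by apply: fsumT_seq => // j /Ls->; rewrite mul0r.
rewrite (@simulv_nat _ _ _ _ p); last first.
  by move=> k pk; rewrite LE big_seq big1 // => j /Up-> //; rewrite mulr0.
under eq_bigr do rewrite LE mulr_suml.
rewrite exchange_big /= mulr_suml big_seq [RHS]big_seq.
apply: eq_bigr => j /Up Uj; rewrite -mulrA.
rewrite -[z ^ j * _](congr1 (@^~ i) (Upsilon_pow_chi j z z0)).
rewrite (simulv_nat _ _ _ _ Uj) mulr_sumr.
by apply: eq_bigr => k _; rewrite mulrA.
Qed.

(** The inverse of [T] cancels, [L(Upsilon)] acts on [chi z] as the scalar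
    [L(z)], and this scalar moves past [S]. *)
Lemma simulv_laurent_connector {R : realType} (n m : nat) (L : int -> R[i])
    (S T : simx R) (z : R[i]) :
  laurent n m L -> z != 0 -> lower_unitriangular S -> lower_unitriangular T ->
  simulv (simul (simul S (laurent_mx L)) (siinv T)) (cmv_poly T z) =
  (fun k => laurent_eval L z * cmv_poly S z k).
Proof.
move=> HL z0 /row_finite_unitriangular fS uT.
have fL := row_finite_laurent_mx _ _ _ HL.
rewrite simulv_siinvK //; last exact: row_finite_mul.
by rewrite simulvA // (laurent_mx_chi _ _ _ _ HL z0) simulv_scale.
Qed.

Theorem proposition16 (R : realType) (u uc1 uc2 : bifunctional R)
  (n1 m1 n2 m2 : nat) (L1 L2 : int -> R[i])
  (HL1 : laurent n1 m1 L1) (HL2 : laurent n2 m2 L2)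
  (Hz1 : laurent_zeros L1 `&` support1 u = set0)
  (Hz2 : laurent_zeros L2 `&` support2 u = set0)
  (Hu1 : geronimus1 L1 u uc1) (Hu2 : geronimus2 L2 u uc2)
  (qG : quasidefinite (gram u))
  (qG1 : quasidefinite (gram uc1)) (qG2 : quasidefinite (gram uc2))
  (S1 H S2 Sc11 Hc1 Sc12 Sc21 Hc2 Sc22 : simx R)
  (HG : gauss_borel (gram u) S1 H S2)
  (HG1 : gauss_borel (gram uc1) Sc11 Hc1 Sc12)
  (HG2 : gauss_borel (gram uc2) Sc21 Hc2 Sc22)
  (Om11 Om12 Om21 Om22 : simx R)
  (HOm11 : Om11 = simul (simul S1 (laurent_mx L1)) (siinv Sc11))
  (HOm12 : Om12 = simul Sc12 (siinv S2))
  (HOm21 : Om21 = simul Sc21 (siinv S1))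
  (HOm22 : Om22 = simul (simul S2 (laurent_mx L2)) (siinv Sc22)) :
  forall z : R[i], z != 0 ->
  [/\ simulv Om11 (cmv_poly Sc11 z) =
        (fun k => laurent_eval L1 z * cmv_poly S1 z k),
      simulv Om12 (cmv_poly S2 z) = cmv_poly Sc12 z,
      simulv Om21 (cmv_poly S1 z) = cmv_poly Sc21 z
    & simulv Om22 (cmv_poly Sc22 z) =
        (fun k => laurent_eval L2 z * cmv_poly S2 z k)].
Proof.
move=> z z0; case: HG HG1 HG2 => [uS1 uS2 _ _] [u11 u12 _ _] [u21 u22 _ _].
rewrite HOm11 HOm12 HOm21 HOm22; split.
- exact: simulv_laurent_connector HL1 z0 uS1 u11.
- by apply: simulv_siinvK => //; exact: row_finite_unitriangular.
- by apply: simulv_siinvK => //; exact: row_finite_unitriangular.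
- exact: simulv_laurent_connector HL2 z0 uS2 u22.
Qed.
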